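(* Let $p$ be a prime number, and let $G=\bigoplus_{i=1}^d\mathbb Z/p^{n_i}\mathbb Z$ (with integers $n_i\ge 1$) be a finite abelian $p$-primary group. (i) If $p=2$, then there is a group isomorphism $$\mathrm{Quad}(G,S^1)\cong\bigoplus_{i=1}^d\mathbb Z/2^{n_i-1}\mathbb Z\oplus\bigoplus_{1\le i<j\le d}\mathbb Z/2^{\min(n_i,n_j)}\mathbb Z\oplus\bigoplus_{i=1}^d\mathbb Z/2^{n_i+1}\mathbb Z.$$ (ii) If $p\ne2$, then there is a group isomorphism $$\mathrm{Quad}(G,S^1)\cong\bigoplus_{i=1}^d\mathbb Z/p^{n_i}\mathbb Z\oplus\bigoplus_{1\le i<j\le d}\mathbb Z/p^{\min(n_i,n_j)}\mathbb Z\oplus\bigoplus_{i=1}^d\mathbb Z/p^{n_i}\mathbb Z.$$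
   Context: For groups $G,H$ and $\varphi\colon G\to H$, put $(\Delta_k\varphi)(g):=\varphi(kg)\varphi(g)^{-1}$ (with the group operation of $G$ written multiplicatively). A map is polynomial of degree $-1$ if it is constantly $1$, and polynomial of degree $d+1$ ($d\ge-1$) if $\Delta_k\varphi$ is polynomial of degree $d$ for all $k\in G$; quadratic means polynomial of degree $2$; unital means that $\varphi$ maps the identity to the identity. $\mathrm{Quad}(G,H)$ is the set of unital quadratic maps $G\to H$; for $H$ abelian it is an abelian group under pointwise multiplication. $S^1$ is the circle group of complex numbers of modulus one. *)

(* Defs.v *)
From HB Require Import structures.
From mathcomp Require Import all_boot all_order all_algebra all_fingroup.
From mathcomp Require Import boolp reals complex.

Set Implicit Arguments.
Unset Strict Implicit.
Unset Printing Implicit Defensive.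

Import Order.TTheory GRing.Theory Num.Theory.

Local Open Scope group_scope.

HB.mixin Record Group_isAbelian G of monoid.Group G := {
  abmulgC : commutative (fun x y : G => x * y)
}.

#[short(type="abGroupType")]
HB.structure Definition AbGroup := {G of Group_isAbelian G & monoid.Group G}.

Definition isomorphic (G H : groupType) : Prop :=
  exists2 f : G -> H, {morph f : x y / x * y} & bijective f.

Section PolynomialMaps.
Variables G H : groupType.

Definition difference (k : G) (phi : G -> H) : G -> H :=
  fun g => phi (k * g) * (phi g)^-1.

(* Degrees start at -1, so the index is shifted by one: [polynomial_lt m phi]
   says that phi is polynomial of degree m - 1. *)
Fixpoint polynomial_lt (m : nat) (phi : G -> H) : Prop :=
  match m with
  | 0 => forall g, phi g = 1
  | m'.+1 => forall k, polynomial_lt m' (difference k phi)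
  end.

Definition quadratic (phi : G -> H) : Prop := polynomial_lt 3 phi.

Definition unital (phi : G -> H) : Prop := phi 1 = 1.

Definition is_quad : pred (G -> H) :=
  fun phi => `[< unital phi /\ quadratic phi >].

Record Quad := MkQuad { quad_fun :> G -> H; _ : is_quad quad_fun }.

HB.instance Definition _ := [isSub for quad_fun].
HB.instance Definition _ := [Choice of Quad by <:].

Lemma quadP (phi : Quad) : unital phi /\ quadratic phi.
Proof. by case: phi => f /= /asboolP. Qed.

End PolynomialMaps.

Section QuadGroup.
Variables (G : groupType) (H : abGroupType).
Implicit Types phi psi : G -> H.

Lemma polynomial_lt1 m : polynomial_lt m (fun _ : G => 1 : H).
Proof.
elim: m => [//|m IH] k /=.
suff -> : difference k (fun _ : G => 1 : H) = (fun _ => 1) by [].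
by apply/funext => g; rewrite /difference mulgV.
Qed.

Lemma polynomial_ltM m phi psi : polynomial_lt m phi -> polynomial_lt m psi ->
  polynomial_lt m (fun g => phi g * psi g).
Proof.
elim: m phi psi => [|m IH] phi psi /= hphi hpsi.
  by move=> g; rewrite hphi hpsi mulg1.
move=> k.
suff -> : difference k (fun g => phi g * psi g) =
    (fun g => difference k phi g * difference k psi g) by apply: IH.
apply/funext => g; rewrite /difference invgM (abmulgC (psi g)^-1) -!mulgA.
by congr (_ * _); rewrite !mulgA (abmulgC (psi _)).
Qed.

Lemma polynomial_ltV m phi :
  polynomial_lt m phi -> polynomial_lt m (fun g => (phi g)^-1).
Proof.
elim: m phi => [|m IH] phi /= hphi; first by move=> g; rewrite hphi invg1.
move=> k.
suff -> : difference k (fun g => (phi g)^-1) =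
    (fun g => (difference k phi g)^-1) by apply: IH.
by apply/funext => g; rewrite /difference invgM abmulgC.
Qed.

Fact quad1_subproof : is_quad (fun _ : G => 1 : H).
Proof. by apply/asboolP; split; last exact: polynomial_lt1. Qed.
Definition quad1 := MkQuad quad1_subproof.

Fact quadM_subproof (phi psi : Quad G H) : is_quad (fun g => phi g * psi g).
Proof.
case: (quadP phi) (quadP psi) => [u1 q1] [u2 q2]; apply/asboolP; split.
  by rewrite /unital u1 u2 mulg1.
exact: polynomial_ltM.
Qed.
Definition quadM (phi psi : Quad G H) := MkQuad (quadM_subproof phi psi).

Fact quadV_subproof (phi : Quad G H) : is_quad (fun g => (phi g)^-1).
Proof.
case: (quadP phi) => [u q]; apply/asboolP; split.
  by rewrite /unital u invg1.
exact: polynomial_ltV.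
Qed.
Definition quadV (phi : Quad G H) := MkQuad (quadV_subproof phi).

Fact quadMA : associative quadM.
Proof. by move=> x y z; apply/val_inj/funext => g; apply: mulgA. Qed.
Fact quad1M : left_id quad1 quadM.
Proof. by move=> x; apply/val_inj/funext => g; apply: mul1g. Qed.
Fact quadM1 : right_id quad1 quadM.
Proof. by move=> x; apply/val_inj/funext => g; apply: mulg1. Qed.
Fact quadVM : left_inverse quad1 quadV quadM.
Proof. by move=> x; apply/val_inj/funext => g; apply: mulVg. Qed.
Fact quadMV : right_inverse quad1 quadV quadM.
Proof. by move=> x; apply/val_inj/funext => g; apply: mulgV. Qed.
Fact quadMC : commutative quadM.
Proof. by move=> x y; apply/val_inj/funext => g; apply: abmulgC. Qed.

HB.instance Definition _ :=
  isGroup.Build (Quad G H) quadMA quad1M quadM1 quadVM quadMV.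
HB.instance Definition _ := Group_isAbelian.Build (Quad G H) quadMC.

End QuadGroup.

Section Circle.
Variable R : realType.
Local Open Scope ring_scope.

Record circle := MkCircle { circle_val :> R[i]; _ : `|circle_val| == 1 }.

HB.instance Definition _ := [isSub for circle_val].
HB.instance Definition _ := [Choice of circle by <:].

Lemma norm_circle (z : circle) : `|z : R[i]| = 1.
Proof. exact/eqP/(valP z). Qed.

Lemma circle_neq0 (z : circle) : (z : R[i]) != 0.
Proof. by rewrite -normr_gt0 norm_circle. Qed.

Fact circle1_subproof : `|1 : R[i]| == 1.
Proof. by rewrite normr1. Qed.
Definition circle1 := MkCircle circle1_subproof.

Fact circleM_subproof (x y : circle) : `|(x : R[i]) * y| == 1.
Proof. by rewrite normrM !norm_circle mulr1. Qed.
Definition circleM x y := MkCircle (circleM_subproof x y).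

Fact circleV_subproof (x : circle) : `|(x : R[i])^-1| == 1.
Proof. by rewrite normfV norm_circle invr1. Qed.
Definition circleV x := MkCircle (circleV_subproof x).

Fact circleMA : associative circleM.
Proof. by move=> x y z; apply/val_inj/mulrA. Qed.
Fact circle1M : left_id circle1 circleM.
Proof. by move=> x; apply/val_inj/mul1r. Qed.
Fact circleM1 : right_id circle1 circleM.
Proof. by move=> x; apply/val_inj/mulr1. Qed.
Fact circleVM : left_inverse circle1 circleV circleM.
Proof. by move=> x; apply/val_inj/mulVf/circle_neq0. Qed.
Fact circleMV : right_inverse circle1 circleV circleM.
Proof. by move=> x; apply/val_inj/mulfV/circle_neq0. Qed.
Fact circleMC : commutative circleM.
Proof. by move=> x y; apply/val_inj/mulrC. Qed.

HB.instance Definition _ :=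
  isGroup.Build circle circleMA circle1M circleM1 circleVM circleMV.
HB.instance Definition _ := Group_isAbelian.Build circle circleMC.

End Circle.

(* Z/mZ for m > 0, including the trivial group for m = 1, where 'Z_m would be
   Z/2Z; the group law is addition modulo m. *)
Definition Zmod (m : nat) : finGroupType := 'I_m.-1.+1.

(* The direct sum of a finite family, with the componentwise group law. *)
Definition dirsum (I : finType) (A : I -> finGroupType) : finGroupType :=
  {dffun forall i : I, A i}.

Definition ord_pairs (d : nat) : finType := {ij : 'I_d * 'I_d | ij.1 < ij.2}.

(* Main.v *)
(* A unital map phi on an abelian group is quadratic iff its polarization
   B(x, y) = phi(xy) / (phi(x) phi(y)) is bimultiplicative. On a direct sum of
   cyclic groups Z/m_i with generators e_i, phi is then determined by a_i =
   phi(e_i), b_i = B(e_i, e_i) and c_ij = B(e_i, e_j) for i < j. Setting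
   y_i = b_i / a_i^2, it is the map
     x |-> prod_i a_i^(x_i^2) y_i^C(x_i, 2) * prod_(i<j) c_ij^(x_i x_j).
   This is well defined exactly when c_ij is killed by gcd(m_i, m_j) and a_i, y_i
   are killed by m_i, m_i for m_i odd and by 2m_i, m_i/2 for m_i even; so the
   parameters form a direct sum of cyclic groups of these orders, since the
   m-torsion of the circle is cyclic of order m. *)
From HB Require Import structures.
Require Import Defs.
From mathcomp Require Import all_boot all_order all_algebra all_fingroup.
From mathcomp Require Import all_solvable all_field zify.
From mathcomp Require Import boolp reals complex.

Set Implicit Arguments.
Unset Strict Implicit.
Unset Printing Implicit Defensive.

Import Order.TTheory GRing.Theory Num.Theory.

Local Open Scope group_scope.

(** * Powers and products in an abelian group *)

HB.instance Definition _ (H : abGroupType) :=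
  SemiGroup.isCommutativeLaw.Build H (@monoid.mul H) (@abmulgC H).

Section AbelianGroup.
Variable H : abGroupType.
Implicit Types (a b : H) (m n k : nat).

Lemma abexpgM a b n : (a * b) ^+ n = a ^+ n * b ^+ n.
Proof. exact/expgMn/abmulgC. Qed.

Lemma abexpgV a n : a^-1 ^+ n = (a ^+ n)^-1.
Proof. exact: expVgn. Qed.

Lemma expg_dvd a m k : m %| k -> a ^+ m = 1 -> a ^+ k = 1.
Proof. by case/dvdnP => q -> am; rewrite mulnC expgnA am expg1n. Qed.

Lemma expg_modn a m k : a ^+ m = 1 -> a ^+ (k %% m) = a ^+ k.
Proof.
move=> am.
by rewrite {2}(divn_eq k m) expgnDr (expg_dvd (dvdn_mull _ (dvdnn m)) am) mul1g.
Qed.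

(** Bezout: [u * m = v * k + gcdn m k] for some [u] and [v], and both multiples act trivially on
    [a]. *)
Lemma expg_gcdn a m k : 0 < m -> a ^+ m = 1 -> a ^+ k = 1 ->
  a ^+ gcdn m k = 1.
Proof.
move=> m_gt0 am ak; case: (egcdnP k m_gt0) => u v e _.
have := expg_dvd (dvdn_mull u (dvdnn m)) am.
by rewrite e expgnDr (expg_dvd (dvdn_mull v (dvdnn k)) ak) mul1g.
Qed.

Lemma periodic_modn (f : nat -> H) m k :
  (forall x, f (x + m) = f x) -> f (k %% m) = f k.
Proof.
move=> per; rewrite {2}(divn_eq k m) addnC.
by elim: (k %/ m) => [|q IH]; rewrite ?addn0// mulSnr addnA per.
Qed.

End AbelianGroup.

(** * Quadratic maps and their polarizations *)

Section Polarization.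
Variables (G : groupType) (H : abGroupType).
Implicit Types (phi : G -> H) (B : G -> G -> H).

(** [B] is a separate argument so that explicit formulas can be supplied for it; by [polar_value] it
    is determined by [phi]. *)
Definition polar phi B :=
  [/\ forall x y, phi (x * y) = phi x * phi y * B x y,
      forall x y z, B (x * y) z = B x z * B y z
    & forall x y z, B x (y * z) = B x y * B x z].

Lemma polarM phi1 B1 phi2 B2 : polar phi1 B1 -> polar phi2 B2 ->
  polar (fun x => phi1 x * phi2 x) (fun x y => B1 x y * B2 x y).
Proof.
case=> [q1 l1 r1] [q2 l2 r2]; split=> *.
- by rewrite q1 q2 Monoid.mulmACA; congr (_ * _); apply: Monoid.mulmACA.
- by rewrite l1 l2 Monoid.mulmACA.
- by rewrite r1 r2 Monoid.mulmACA.
Qed.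

Lemma polar_prod (I : finType) (phi : I -> G -> H) (B : I -> G -> G -> H) :
  (forall i, polar (phi i) (B i)) ->
  polar (fun x => \prod_i phi i x) (fun x y => \prod_i B i x y).
Proof.
move=> h; split=> *; rewrite -!big_split; apply: eq_bigr => i _;
  by case: (h i).
Qed.

Lemma polar_value phi B x y : polar phi B ->
  B x y = phi (x * y) * (phi y)^-1 * (phi x)^-1.
Proof. by case=> q _ _; rewrite q (AC (3*1*1) (3*(1*5)*(2*4))) /= !mulgV !mulg1. Qed.

Section Calculus.
Variables (phi : G -> H) (B : G -> G -> H).
Hypothesis phiB : polar phi B.

Lemma polar1l y : B 1 y = 1.
Proof. by case: phiB => _ l _; apply: (mulgI (B 1 y)); rewrite -l !mulg1. Qed.

Lemma polar1r x : B x 1 = 1.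
Proof. by case: phiB => _ _ r; apply: (mulgI (B x 1)); rewrite -r !mulg1. Qed.

Lemma polar1 : phi 1 = 1.
Proof.
by case: phiB => q _ _; apply: (mulgI (phi 1)); have := q 1 1;
  rewrite polar1l !mulg1.
Qed.

Lemma polarXl x y n : B (x ^+ n) y = B x y ^+ n.
Proof.
case: phiB => _ l _; elim: n => [|n IH]; first exact: polar1l.
by rewrite !expgS l IH.
Qed.

Lemma polarXr x y n : B x (y ^+ n) = B x y ^+ n.
Proof.
case: phiB => _ _ r; elim: n => [|n IH]; first exact: polar1r.
by rewrite !expgS r IH.
Qed.

(** Passing from x^k to x^(k+1) contributes the factor B(x, x)^k, and these exponents add up to the
    binomial. *)
Lemma polarX x n : phi (x ^+ n) = phi x ^+ n * B x x ^+ 'C(n, 2).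
Proof.
case: phiB => q _ _; elim: n => [|n IH]; first by rewrite polar1 mulg1.
rewrite expgSr q IH polarXl binS bin1 expgSr expgnDr.
by rewrite (AC (2*1*1) ((1*3)*(2*4))).
Qed.

(** The first difference is phi(k) B(k, _), the second is the constant B(k, k'), so the third is
    trivial. *)
Lemma polar_is_quad : is_quad phi.
Proof.
case: phiB => q l r; apply/asboolP; split; first exact: polar1.
have d1 k g : difference k phi g = phi k * B k g.
  by rewrite /difference q (AC ((2*1)*1) ((1*3)*(2*4))) /= mulgV mulg1.
have d2 k k' g : difference k' (difference k phi) g = B k k'.
  rewrite {1}/difference !d1 r invgM !mulgA mulgK.
  by rewrite [phi k * _]abmulgC mulgK.
by move=> k k' k'' g; rewrite {1}/difference !d2 mulgV.
Qed.

End Calculus.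

Section Commutative.
Hypothesis mulC : commutative (@monoid.mul G).

Lemma polar_sym phi B x y : polar phi B -> B x y = B y x.
Proof.
move=> phiB; rewrite !(polar_value _ _ phiB) mulC -!mulgA.
by congr (_ * _); rewrite abmulgC.
Qed.

(** A trivial third difference makes the second one constant, and its value at 1 is B(k, l). Reading
    this at an arbitrary g gives multiplicativity in the second argument; symmetry, from
    commutativity of [G], carries it to the first. *)
Lemma quad_polar phi : is_quad phi ->
  polar phi (fun x y => phi (x * y) * (phi y)^-1 * (phi x)^-1).
Proof.
move=> /asboolP[u q]; set B := fun x y => _.
have d g k l : phi (k * (l * g)) * phi g = B k l * phi (l * g) * phi (k * g).
  have dm m : difference l (difference k phi) m = B k l.
    have := q k l m 1; rewrite {1}/difference mulg1 => /divg1_eq ->.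
    by rewrite /difference !mulg1 u invg1 mulg1.
  rewrite -(dm g) /difference invgM invgK.
  set a := phi _; set b := phi g; set c := phi (l * g); set e := phi (k * g).
  rewrite (AC ((2*2)*1*1) ((1*3)*(2*5)*(4*6))) /=.
  by rewrite mulVg mulVg !mulg1.
have r k l g : B k (l * g) = B k l * B k g.
  have e : phi (k * (l * g)) = B k l * phi (l * g) * phi (k * g) * (phi g)^-1.
    by rewrite -d mulgK.
  rewrite {1}/B e (AC (4*1*1) ((1*(3*4*6))*(2*5))) /= mulgV mulg1.
  by rewrite /B.
have sym x y : B x y = B y x.
  by rewrite /B mulC -!mulgA; congr (_ * _); apply: abmulgC.
split=> [x y|x y z|//]; last by rewrite sym r ![B z _]sym.
by rewrite /B (AC (2*3) ((3*(2*4))*(1*5))) /= !mulgV !mulg1.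
Qed.

End Commutative.

End Polarization.

(** * Orders of the parameters at one generator *)

(* The largest possible orders of [a] and [y] for which [a ^+ (k ^ 2)], resp.
   [y ^+ 'C(k, 2)], is [m]-periodic in [k]. *)
Definition square_order m := if odd m then m else m.*2.
Definition binomial_order m := if odd m then m else m./2.

Lemma square_order_gt0 m : 0 < m -> 0 < square_order m.
Proof. by rewrite /square_order; case: ifP => // _; lia. Qed.

Lemma binomial_order_gt0 m : 0 < m -> 0 < binomial_order m.
Proof. by rewrite /binomial_order; case: ifP => // o; lia. Qed.

Lemma square_order_dvd_double m : square_order m %| 2 * m.
Proof. by rewrite /square_order mul2n; case: ifP => _; rewrite // -mul2n dvdn_mull. Qed.

Lemma square_order_dvd_sqr m : square_order m %| m ^ 2.
Proof.
rewrite /square_order; case: ifP => o; first exact: dvdn_mulr.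
by rewrite -mul2n mulnC dvdn_mul// dvdn2 o.
Qed.

Lemma binomial_order_dvd m : binomial_order m %| m.
Proof.
rewrite /binomial_order; case: ifP => // /negbT/even_halfK {2}<-.
by rewrite -mul2n dvdn_mull.
Qed.

Lemma binomial_order_dvd_bin m : binomial_order m %| 'C(m, 2).
Proof.
rewrite /binomial_order bin2; case: ifP => o.
  have -> : ((m * m.-1)./2 = m * m.-1./2)%N.
    by rewrite -divn2 -muln_divA ?divn2// dvdn2; case: m o => //= m /negbTE->.
  exact: dvdn_mulr.
have -> : ((m * m.-1)./2 = m./2 * m.-1)%N.
  by rewrite -divn2 -divn_mulAC ?divn2// dvdn2 o.
exact: dvdn_mulr.
Qed.

Section Orders.
Variables (H : abGroupType) (a b : H) (m : nat).
(** For e^m = 1, a = phi(e) and b = B(e, e), these are the relations B(e^m, e) = 1 and phi(e^m) =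
    1. *)
Hypotheses (bm : b ^+ m = 1) (abm : a ^+ m * b ^+ 'C(m, 2) = 1).

(** For odd m, m divides C(m, 2), so a^m = 1. For even m, a^m is the inverse of b^C(m, 2), whose
    square is b^(m(m-1)) = 1. *)
Lemma square_orderP : a ^+ square_order m = 1.
Proof.
rewrite /square_order; case: ifP => o.
  move: abm; rewrite (expg_dvd _ bm) ?mulg1//.
  by have := binomial_order_dvd_bin m; rewrite /binomial_order o.
rewrite -muln2 expgnA; have -> : a ^+ m = (b ^+ 'C(m, 2))^-1.
  by rewrite -[LHS]mulg1 -(mulgV (b ^+ 'C(m, 2))) mulgA abm mul1g.
rewrite abexpgV -expgnA (expg_dvd _ bm) ?invg1//.
have -> : ('C(m, 2) * 2 = m * m.-1)%N.
  by rewrite bin2 muln2 even_halfK// oddM negb_and; case: (m) o => //= ? ->.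
exact: dvdn_mulr.
Qed.

(** For odd m, both factors are killed by m. For even m, replacing a^m by the inverse of b^C(m, 2)
    leaves b to the exponent m/2 + C(m, 2) = (m/2) m. *)
Lemma binomial_orderP : (b * (a ^+ 2)^-1) ^+ binomial_order m = 1.
Proof.
rewrite abexpgM abexpgV -expgnA /binomial_order; case: ifP => o.
  have am : a ^+ m = 1 by have := square_orderP; rewrite /square_order o.
  by rewrite bm mul1g mulnC expgnA am expg1n invg1.
rewrite mul2n even_halfK ?o//; apply/eqP; rewrite divg_eq1; apply/eqP.
apply: (mulIg (b ^+ 'C(m, 2))); rewrite abm -expgnDr (expg_dvd _ bm)//.
have -> : (m./2 + 'C(m, 2) = m./2 * m)%N.
  have -> : 'C(m, 2) = (m./2 * m.-1)%N.
    by rewrite bin2 -divn2 -divn_mulAC ?divn2// dvdn2 o.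
  by case: (m) => // k; rewrite -mulnS.
exact: dvdn_mull.
Qed.

End Orders.

(** * Direct sums of cyclic groups *)

Lemma ZmodM m (x y : Zmod m) : 0 < m ->
  nat_of_ord (x * y) = ((nat_of_ord x + nat_of_ord y) %% m)%N.
Proof. by case: m x y. Qed.

Lemma ZmodC m : commutative (@monoid.mul (Zmod m)).
Proof. by move=> x y; apply/val_inj; rewrite /= addnC. Qed.

Section DirectSum.
Variables (d : nat) (m : 'I_d -> nat).
Hypothesis m_gt1 : forall i, 1 < m i.

Let m_gt0 i : 0 < m i.
Proof. exact: ltnW. Qed.

Local Notation G := (dirsum (fun i : 'I_d => Zmod (m i))).

Definition residue (i : 'I_d) (x : G) : nat := nat_of_ord (x i).

(** The boolean [i == k] is read as 0 or 1, which [inord] preserves since [1 < m k]. *)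
Definition unit_vector (i : 'I_d) : G :=
  [ffun k : 'I_d => inord (i == k) : Zmod (m k)].

Lemma residueM i x y : residue i (x * y) = ((residue i x + residue i y) %% m i)%N.
Proof. by rewrite /residue ffunE ZmodM. Qed.

Lemma residue_unit_vector i k : residue k (unit_vector i) = (i == k).
Proof.
rewrite /residue ffunE inordK// prednK//.
by case: eqP.
Qed.

Lemma dirsumC : commutative (@monoid.mul G).
Proof. by move=> x y; apply/ffunP => i; rewrite !ffunE ZmodC. Qed.

Lemma residueX i x n : residue i (x ^+ n) = ((n * residue i x) %% m i)%N.
Proof.
elim: n => [|n IH]; first by rewrite mod0n /residue ffunE.
by rewrite expgS residueM IH modnDmr -mulSn.
Qed.

Lemma residue_inj x y : (forall i, residue i x = residue i y) -> x = y.
Proof. by move=> h; apply/ffunP => i; apply/val_inj/h. Qed.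

Lemma residue1 i : residue i 1 = 0.
Proof. by rewrite /residue ffunE. Qed.

Lemma residue_lt i x : residue i x < m i.
Proof. by rewrite /residue -[X in _ < X]prednK. Qed.

Lemma unit_vectorX i : unit_vector i ^+ m i = 1.
Proof.
apply: residue_inj => k; rewrite residueX residue1 residue_unit_vector.
by case: eqP => [->|_]; rewrite ?muln1 ?modnn// muln0 mod0n.
Qed.

Lemma dirsum_decomposition x : x = \prod_i unit_vector i ^+ residue i x.
Proof.
apply: residue_inj => k.
rewrite [in RHS]/residue (big_morph _ (@dffunM _ _ k) (_ : _ = 1)) ?ffunE//.
rewrite (big_only1 k)//= => [|i /negPf ik _].
  rewrite -/(residue k _) residueX residue_unit_vector eqxx muln1.
  by rewrite modn_small ?residue_lt.
apply/val_inj; rewrite /= -/(residue k _) residueX residue_unit_vector ik.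
by rewrite muln0 mod0n.
Qed.

Lemma dirsum_ind (P : G -> Prop) : P 1 ->
  (forall x i, P x -> P (x * unit_vector i)) -> forall x, P x.
Proof.
move=> P1 PM x; rewrite (dirsum_decomposition x) -[\prod_i _]mul1g.
suff : forall z, P z -> P (z * \prod_i unit_vector i ^+ residue i x) by apply.
(* [P] is not assumed closed under products, but [Q] is, so the big product can be handled factor by
   factor. *)
pose Q y := forall z, P z -> P (z * y); rewrite -/(Q _).
apply: big_ind => [z|y y' Qy Qy' z Pz|i _]; first by rewrite mulg1.
  by rewrite mulgA; apply/Qy'/Qy.
elim: (residue i x) => [|n IH] z Pz; first by rewrite mulg1.
by rewrite expgSr mulgA; apply/PM/IH.
Qed.

Variable H : abGroupType.
Implicit Types (phi : G -> H) (B : G -> G -> H).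

(** Symmetry of the polarizations covers i > j. Adding one generator at a time then extends the
    agreement to B(x, e_j), and with it to phi. *)
Lemma polar_ext phi B phi' B' : polar phi B -> polar phi' B' ->
    (forall i, phi (unit_vector i) = phi' (unit_vector i)) ->
    (forall i j : 'I_d, i <= j -> B (unit_vector i) (unit_vector j) =
                           B' (unit_vector i) (unit_vector j)) ->
  phi =1 phi'.
Proof.
move=> pB pB' e eB.
have e2 i j : B (unit_vector i) (unit_vector j) =
              B' (unit_vector i) (unit_vector j).
  case: (leqP i j) => [/eB//|/ltnW/eB].
  by rewrite (polar_sym dirsumC _ _ pB) (polar_sym dirsumC _ _ pB').
have [q l r] := pB; have [q' l' r'] := pB'.
have e1 x j : B x (unit_vector j) = B' x (unit_vector j).
  elim/dirsum_ind: x => [|x i IH]; first by rewrite (polar1l pB) (polar1l pB').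
  by rewrite l l' IH e2.
elim/dirsum_ind => [|x i IH]; first by rewrite (polar1 pB) (polar1 pB').
by rewrite q q' IH e e1.
Qed.

(** Reduction modulo m is harmless: (k + m)^2 exceeds k^2 by 2km + m^2, and [square_order] divides
    both 2m and m^2. *)
Lemma polar_residue_square i (a : H) : a ^+ square_order (m i) = 1 ->
  polar (fun x => a ^+ (residue i x ^ 2))
        (fun x y => a ^+ (2 * residue i x * residue i y)).
Proof.
move=> am.
have a2m k : (a ^+ (2 * k)) ^+ m i = 1.
  rewrite -expgnA mulnAC (expg_dvd _ am)//.
  by rewrite dvdn_mulr// square_order_dvd_double.
split=> [x y|x y z|x y z]; rewrite residueM.
- rewrite (periodic_modn (f := fun k => a ^+ (k ^ 2))) => [|k].
    by rewrite -!expgnDr; congr (_ ^+ _); rewrite sqrnD -mulnA.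
  rewrite sqrnD -addnA expgnDr [X in _ * X](expg_dvd _ am) ?mulg1//.
  rewrite dvdn_add ?square_order_dvd_sqr// mulnCA dvdn_mull//.
  by rewrite square_order_dvd_double.
- by rewrite mulnAC expgnA expg_modn// -expgnDr -expgnA; congr (_ ^+ _); lia.
- by rewrite expgnA expg_modn// -expgnA mulnDr expgnDr.
Qed.

(** Here C(k + m, 2) exceeds C(k, 2) by C(m, 2) + km, and [binomial_order] divides both C(m, 2) and
    m. *)
Lemma polar_residue_binomial i (a : H) : a ^+ binomial_order (m i) = 1 ->
  polar (fun x => a ^+ 'C(residue i x, 2))
        (fun x y => a ^+ (residue i x * residue i y)).
Proof.
move=> aN; have am : a ^+ m i = 1 by apply: expg_dvd (binomial_order_dvd _) aN.
have amk k : (a ^+ k) ^+ m i = 1 by rewrite -expgnA mulnC expgnA am expg1n.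
have binD p q : 'C(p + q, 2) = ('C(p, 2) + 'C(q, 2) + p * q)%N.
  by elim: p => [|p IH]; rewrite ?addn0// addSn !binS !bin1 IH; lia.
split=> [x y|x y z|x y z]; rewrite residueM.
- rewrite (periodic_modn (f := fun k => a ^+ 'C(k, 2))) => [|k].
    by rewrite -!expgnDr binD.
  rewrite binD !expgnDr [a ^+ 'C(m i, 2)](expg_dvd _ aN) ?mulg1.
    by rewrite expgnA amk mulg1.
  exact: binomial_order_dvd_bin.
- by rewrite mulnC expgnA expg_modn// -expgnDr -expgnA; congr (_ ^+ _); lia.
- by rewrite expgnA expg_modn// -expgnA mulnDr expgnDr.
Qed.

(** Since [a] is killed by both [m i] and [m j], each residue in the exponent can be reduced by its
    own modulus. *)
Lemma polar_residue_product i j (a : H) : a ^+ gcdn (m i) (m j) = 1 ->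
  polar (fun x => a ^+ (residue i x * residue j x))
        (fun x y => a ^+ (residue i x * residue j y + residue j x * residue i y)).
Proof.
move=> aK.
have ami : a ^+ m i = 1 by apply: expg_dvd aK; apply: dvdn_gcdl.
have amj : a ^+ m j = 1 by apply: expg_dvd aK; apply: dvdn_gcdr.
have aik k : (a ^+ k) ^+ m i = 1 by rewrite -expgnA mulnC expgnA ami expg1n.
have ajk k : (a ^+ k) ^+ m j = 1 by rewrite -expgnA mulnC expgnA amj expg1n.
have modi p q : a ^+ (p %% m i * q) = a ^+ (p * q).
  by rewrite mulnC expgnA expg_modn// -expgnA mulnC.
have modj p q : a ^+ (q * (p %% m j)) = a ^+ (q * p).
  by rewrite expgnA expg_modn// -expgnA.
split=> [x y|x y z|x y z]; rewrite !residueM ?expgnDr.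
- by rewrite modi modj -!expgnDr; congr (_ ^+ _); lia.
- by rewrite modi ![((residue j _ + _) %% _ * _)%N]mulnC modj -!expgnDr; congr (_ ^+ _); lia.
- by rewrite modj ![(residue j _ * _)%N]mulnC modi -!expgnDr; congr (_ ^+ _); lia.
Qed.

End DirectSum.

(** * Classification over a group with cyclic torsion *)

(** For m > 0 this makes the m-torsion of [H] cyclic of order m; the classification needs nothing
    more of the circle. *)
Definition torsion_generator (H : groupType) (m : nat) (z : H) :=
  [/\ z ^+ m = 1, forall i j, i < m -> j < m -> z ^+ i = z ^+ j -> i = j
    & forall y, y ^+ m = 1 -> exists2 i, i < m & y = z ^+ i].

Lemma bijective_isomorphic (G H : groupType) (f : H -> G) :
  {morph f : x y / x * y} -> injective f -> (forall y, exists x, f x = y) ->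
  isomorphic G H.
Proof.
move=> fM finj fsurj; have [g fK] := choice fsurj.
by exists g => [x y|]; [apply: finj; rewrite fM !fK | exists f => // x; apply: finj].
Qed.

Section Classification.
Variables (H : abGroupType) (zeta : nat -> H).
Hypothesis zetaP : forall m, 0 < m -> torsion_generator m (zeta m).
Variables (d : nat) (m : 'I_d -> nat).
Hypothesis m_gt1 : forall i, 1 < m i.

(** The orders are variables tied by equations, so that types such as [Zmod (2 ^ (n i - 1))] fit as
    they stand, without transport between dependent types. *)
Variables (N M : 'I_d -> nat) (K : ord_pairs d -> nat).
Hypotheses (NE : forall i, N i = binomial_order (m i))
  (KE : forall ij, K ij = gcdn (m (sval ij).1) (m (sval ij).2))
  (ME : forall i, M i = square_order (m i)).

Let m_gt0 i : 0 < m i. Proof. exact: ltnW. Qed.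
Let N_gt0 i : 0 < N i. Proof. by rewrite NE binomial_order_gt0. Qed.
Let M_gt0 i : 0 < M i. Proof. by rewrite ME square_order_gt0. Qed.
Let K_gt0 ij : 0 < K ij. Proof. by rewrite KE gcdn_gt0 m_gt0. Qed.

Local Notation G := (dirsum (fun i : 'I_d => Zmod (m i))).
(** Through [chi], [t.1.1] encodes the y_i, [t.1.2] the c_ij and [t.2] the a_i. *)
Local Notation T :=
  (dirsum (fun i => Zmod (N i)) * dirsum (fun ij => Zmod (K ij)) *
   dirsum (fun i => Zmod (M i)))%type.

Definition chi n (k : Zmod n) : H := zeta n ^+ nat_of_ord k.

Lemma chiM n (k l : Zmod n) : 0 < n -> chi (k * l) = chi k * chi l.
Proof.
move=> n_gt0; have [z1 _ _] := zetaP n_gt0.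
by rewrite /chi ZmodM// expg_modn// expgnDr.
Qed.

Lemma chi_inj n : 0 < n -> injective (@chi n).
Proof.
move=> n_gt0 k l; have [_ zi _] := zetaP n_gt0 => /zi e.
by apply/val_inj/e; rewrite -[X in _ < X]prednK.
Qed.

Lemma chi_order n (k : Zmod n) : 0 < n -> chi k ^+ n = 1.
Proof.
move=> n_gt0; have [z1 _ _] := zetaP n_gt0.
by rewrite /chi -expgnA mulnC expgnA z1 expg1n.
Qed.

Lemma chi_surj n (y : H) : y ^+ n = 1 -> 0 < n -> exists k : Zmod n, chi k = y.
Proof.
move=> yn n_gt0; have [_ _ zs] := zetaP n_gt0; have [i ltin ->] := zs y yn.
by exists (inord i : Zmod n); rewrite /chi inordK ?prednK.
Qed.

(* For m = 2 ^ n, the value at the generator has order up to 2m, so squares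
   rather than linear terms must carry it; this is what makes the group split as
   Z/(m/2) + Z/2m, with the same formula giving Z/m + Z/m for odd m. *)
Definition form_fun (t : T) (x : G) : H :=
  (\prod_i (chi (t.2 i) ^+ (residue i x ^ 2) *
            chi (t.1.1 i) ^+ 'C(residue i x, 2))) *
  \prod_ij (chi (t.1.2 ij) ^+ (residue (sval ij).1 x * residue (sval ij).2 x)).

Definition form_polar (t : T) (x y : G) : H :=
  (\prod_i (chi (t.2 i) ^+ (2 * residue i x * residue i y) *
            chi (t.1.1 i) ^+ (residue i x * residue i y))) *
  \prod_ij (chi (t.1.2 ij) ^+ (residue (sval ij).1 x * residue (sval ij).2 y +
                               residue (sval ij).2 x * residue (sval ij).1 y)).

Lemma form_polarP t : polar (form_fun t) (form_polar t).
Proof.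
apply: polarM; apply: polar_prod => i; [apply: polarM|].
- by apply: polar_residue_square; rewrite -?ME ?chi_order.
- by apply: polar_residue_binomial; rewrite -?NE ?chi_order.
- by apply: polar_residue_product; rewrite -?KE ?chi_order.
Qed.

Definition form (t : T) : Quad G H := MkQuad (polar_is_quad (form_polarP t)).

Lemma formM : {morph form : s t / s * t}.
Proof.
move=> s t; apply/val_inj/funext => x.
rewrite -[RHS]/(form_fun s x * form_fun t x) -[LHS]/(form_fun (s * t) x).
rewrite /form_fun [RHS]Monoid.mulmACA /= -!big_split /=.
congr (_ * _); apply: eq_bigr => i _; last by rewrite ffunE chiM// abexpgM.
by rewrite !ffunE !chiM// !abexpgM Monoid.mulmACA.
Qed.

Local Notation e := (unit_vector m).

Lemma form_unit_vector t i : form_fun t (e i) = chi (t.2 i).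
Proof.
rewrite /form_fun [X in _ * X]big1 ?mulg1 => [|ij _]; last first.
  (* A nontrivial cross term at e_i would need both indices equal to i, but the pair is strictly
     increasing. *)
  rewrite !residue_unit_vector//; case: eqP => [->|]//; case: eqP => // ii.
  by have := valP ij; rewrite /= -ii ltnn.
rewrite (bigD1 i)//= big1 ?mulg1 => [|j /negPf ji].
  by rewrite residue_unit_vector// eqxx mulg1.
by rewrite residue_unit_vector// eq_sym ji mulg1.
Qed.

Lemma form_polar_diag t i :
  form_polar t (e i) (e i) = chi (t.2 i) ^+ 2 * chi (t.1.1 i).
Proof.
rewrite /form_polar [X in _ * X]big1 ?mulg1 => [|ij _]; last first.
  rewrite !residue_unit_vector//; case: eqP => [->|]//; case: eqP => // ii.
  by have := valP ij; rewrite /= -ii ltnn.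
rewrite (bigD1 i)//= big1 ?mulg1 => [|j /negPf ji].
  by rewrite residue_unit_vector// eqxx.
by rewrite residue_unit_vector// eq_sym ji mulg1.
Qed.

Lemma form_polar_lt t (ij : ord_pairs d) :
  form_polar t (e (sval ij).1) (e (sval ij).2) = chi (t.1.2 ij).
Proof.
have lt := valP ij; rewrite /form_polar big1 ?mul1g => [|k _]; last first.
  rewrite !residue_unit_vector//; case: eqP => [<-|_]; last by rewrite muln0 mulg1.
  by rewrite eq_sym; case: eqP lt => [->|]; rewrite ?ltnn// mulg1.
rewrite (bigD1 ij)//= big1 ?mulg1 => [|kl /eqP klij].
  rewrite !residue_unit_vector// !eqxx.
  by case: eqP lt => [->|]; rewrite ?ltnn.
rewrite !residue_unit_vector// !mulnb.
have -> : ((sval ij).1 == (sval kl).1) && ((sval ij).2 == (sval kl).2) = false.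
  apply/negP => /andP[/eqP e1 /eqP e2]; apply: klij; apply: val_inj.
  by rewrite [LHS]surjective_pairing [RHS]surjective_pairing; congr pair.
(* The transposed pair cannot occur, as both pairs are increasing. *)
have -> // : ((sval ij).1 == (sval kl).2) && ((sval ij).2 == (sval kl).1) = false.
apply/negP => /andP[/eqP e1 /eqP e2].
by have := valP kl; rewrite /= -e1 -e2 ltnNge ltnW.
Qed.

(** The a_i are values at generators; cancelling a_i^2 in B(e_i, e_i) gives y_i, and c_ij is B(e_i,
    e_j). *)
Lemma form_inj : injective form.
Proof.
move=> s t /(congr1 (@quad_fun _ _)) /= st.
have pol x y : form_polar s x y = form_polar t x y.
  by rewrite (polar_value _ _ (form_polarP s)) (polar_value _ _ (form_polarP t)) st.
have e2 : s.2 = t.2.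
  by apply/ffunP => i; apply: (chi_inj (M_gt0 i)); rewrite -!form_unit_vector st.
have e11 : s.1.1 = t.1.1.
  apply/ffunP => i; apply: (chi_inj (N_gt0 i)).
  by have := pol (e i) (e i); rewrite !form_polar_diag e2 => /mulgI.
have e12 : s.1.2 = t.1.2.
  by apply/ffunP => ij; apply: (chi_inj (K_gt0 ij)); rewrite -!form_polar_lt pol.
by case: (s) (t) e2 e11 e12 => [[? ?] ?] [[? ?] ?] /= -> -> ->.
Qed.

Lemma form_surj (phi : Quad G H) : exists t, form t = phi.
Proof.
have := quad_polar (@dirsumC d m) (valP phi).
set B := (B in polar _ B) => phiB.
(* Evaluating on e_i^(m_i) = 1 gives the relations that bound the orders of the parameters. *)
have Bm i j : B (e i) (e j) ^+ m i = 1.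
  by rewrite -(polarXl phiB) unit_vectorX// (polar1l phiB).
have Bmr i j : B (e i) (e j) ^+ m j = 1.
  by rewrite -(polarXr phiB) unit_vectorX// (polar1r phiB).
have am i : phi (e i) ^+ m i * B (e i) (e i) ^+ 'C(m i, 2) = 1.
  by rewrite -(polarX phiB) unit_vectorX// (polar1 phiB).
have sq i : exists k : Zmod (M i), chi k = phi (e i).
  by apply: chi_surj => //; rewrite ME; apply: square_orderP (Bm i i) (am i).
have bi i : exists k : Zmod (N i), chi k = B (e i) (e i) * (phi (e i) ^+ 2)^-1.
  by apply: chi_surj => //; rewrite NE; apply: binomial_orderP (Bm i i) (am i).
have cr ij : exists k : Zmod (K ij), chi k = B (e (sval ij).1) (e (sval ij).2).
  by apply: chi_surj => //; rewrite KE; apply: expg_gcdn.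
pose v : dirsum (fun i => Zmod (M i)) := [ffun i : 'I_d => projT1 (cid (sq i))].
pose u : dirsum (fun i => Zmod (N i)) := [ffun i : 'I_d => projT1 (cid (bi i))].
pose c : dirsum (fun ij => Zmod (K ij)) :=
  [ffun ij : ord_pairs d => projT1 (cid (cr ij))].
exists (u, c, v); apply/val_inj/funext.
apply: (polar_ext m_gt1 (form_polarP _) phiB) => [i|i j].
  by rewrite form_unit_vector /= ffunE; case: cid.
rewrite leq_eqVlt => /orP[/eqP/val_inj <-|ltij].
  rewrite form_polar_diag /= !ffunE; case: cid => /= a ->; case: cid => /= b ->.
  by rewrite abmulgC mulgVK.
pose ij : ord_pairs d := exist _ (i, j) ltij.
rewrite (form_polar_lt (u, c, v) ij : form_polar _ (e i) (e j) = _) /= ffunE.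
by case: cid.
Qed.

Theorem Quad_dirsum_isomorphic : isomorphic (Quad G H) T.
Proof. exact: bijective_isomorphic formM form_inj form_surj. Qed.

End Classification.

(** * Roots of unity on the circle *)

Section CircleTorsion.
Variable R : realType.
Local Open Scope ring_scope.

(** X^n - 1 splits and is separable, so it has n distinct roots, and n distinct n-th roots of unity
    include a primitive one. *)
Lemma closed_primitive_root (F : numClosedFieldType) (n : nat) : (0 < n)%N ->
  exists z : F, n.-primitive_root z.
Proof.
move=> n_gt0; have [r rE] := closed_field_poly_normal ('X^n - 1 : {poly F}).
have {}rE : 'X^n - 1 = \prod_(z <- r) ('X - z%:P).
  by rewrite rE (monicP (monicXnsubC _ _)) ?scale1r.
suff /hasP[z _ zn] : has n.-primitive_root r by exists z.
apply: has_prim_root => //.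
- by apply/allP => z zr; rewrite /root_of_unity rE root_prod_XsubC.
- by rewrite -separable_prod_XsubC -rE separable_Xn_sub_1// pnatr_eq0 -lt0n.
- by rewrite -ltnS -(size_prod_XsubC r id) -rE size_XnsubC.
Qed.

Lemma circleX (z : circle R) k : circle_val (z ^+ k)%g = circle_val z ^+ k.
Proof. by elim: k => [//|k IH]; rewrite expgS exprS -IH. Qed.

Lemma circle_torsion_generator n : (0 < n)%N ->
  exists z : circle R, torsion_generator n z.
Proof.
move=> n_gt0; have [z zn] := closed_primitive_root R[i] n_gt0.
have z1 : `|z| == 1.
  by rewrite -(pexpr_eq1 n_gt0)// -normrX (prim_expr_order zn) normr1.
exists (MkCircle z1); split.
- by apply/val_inj; rewrite /= circleX (prim_expr_order zn).
- move=> i j lti ltj /(congr1 (@circle_val R)); rewrite !circleX /= => /eqP.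
  by rewrite (eq_prim_root_expr zn) !modn_small// => /eqP.
- move=> y /(congr1 (@circle_val R)); rewrite circleX => /(prim_rootP zn)[i yi].
  by exists i => //; apply/val_inj; rewrite /= circleX.
Qed.

End CircleTorsion.

(** * Specialization to prime powers *)

Lemma gcdn_exp2l p a b : gcdn (p ^ a) (p ^ b) = (p ^ minn a b)%N.
Proof.
wlog ab : a b / a <= b.
  by move=> h; case/orP: (leq_total a b) => /h // e; rewrite gcdnC e minnC.
by rewrite (minn_idPl ab); apply/gcdn_idPl; rewrite dvdn_exp2l.
Qed.

Local Close Scope group_scope.

Theorem proposition1p6 (R : realType) (p d : nat) (n : 'I_d -> nat)
  (p_prime : prime p) (n_ge1 : forall i, 1 <= n i) :
  let G := dirsum (fun i : 'I_d => Zmod (p ^ n i)) in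
  (p = 2 ->
     isomorphic (Quad G (circle R))
       (dirsum (fun i : 'I_d => Zmod (2 ^ (n i - 1))) *
        dirsum (fun ij : ord_pairs d =>
                  Zmod (2 ^ minn (n (sval ij).1) (n (sval ij).2))) *
        dirsum (fun i : 'I_d => Zmod (2 ^ (n i + 1))))%type) /\
  (p <> 2 ->
     isomorphic (Quad G (circle R))
       (dirsum (fun i : 'I_d => Zmod (p ^ n i)) *
        dirsum (fun ij : ord_pairs d =>
                  Zmod (p ^ minn (n (sval ij).1) (n (sval ij).2))) *
        dirsum (fun i : 'I_d => Zmod (p ^ n i)))%type).
Proof.
have zetaE k : exists z : circle R, 0 < k -> torsion_generator k z.
  (* At 0 any value will do; it only makes [zeta] a total function. *)
  case: k => [|k]; first by exists 1%g.
  by have [z zk] := circle_torsion_generator R (ltn0Sn k); exists z.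
have [zeta zetaP] := choice zetaE.
have m_gt1 i : 1 < p ^ n i by rewrite -(expn0 p) ltn_exp2l// prime_gt1.
split=> p2; apply: (Quad_dirsum_isomorphic zetaP m_gt1) => i; rewrite ?gcdn_exp2l ?p2//.
(* Since [n i] is positive, the truncated [n i - 1] is exact and 2^(n i) is even, so its half is
   taken. *)
- case: (n i) (n_ge1 i) => // k _.
  by rewrite /binomial_order oddX /= expnS mul2n doubleK subn1.
- case: (n i) (n_ge1 i) => // k _.
  by rewrite /square_order oddX /= addn1 expnS mul2n.
(* For p other than 2 the power is odd, so both orders are p^(n i) itself. *)
- by rewrite /binomial_order oddX; case: (even_prime p_prime) => // ->; rewrite orbT.
- by rewrite /square_order oddX; case: (even_prime p_prime) => // ->; rewrite orbT.
Qed.
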